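(* Let $\lambda$ be a real number, $\alpha>0$, and let $X$ be a degenerate Poisson random variable with parameter $\alpha$. Then for every integer $n\ge0$, $$E\big[\langle X\rangle_n\big]=\sum_{k=0}^{n}B_{k,\lambda}(\alpha)\,|S_1(n,k)|,$$ where $|S_1(n,k)|$ are the unsigned Stirling numbers of the first kind and $B_{k,\lambda}$ are the dimorphic degenerate Bell polynomials. In particular, $$B^L_{n,\lambda}(\alpha)=\sum_{k=0}^{n}B_{k,\lambda}(\alpha)\,|S_1(n,k)|.$$
   Context: The rising factorial is $\langle x\rangle_0=1$, $\langle x\rangle_n=x(x+1)\cdots(x+n-1)$. The $\lambda$-falling factorial is $(x)_{0,\lambda}=1$, $(x)_{n,\lambda}=x(x-\lambda)\cdots(x-(n-1)\lambda)$ for $n\ge1$. The degenerate exponential is $e_\lambda^x(t)=\sum_{n\ge0}(x)_{n,\lambda}\frac{t^n}{n!}$ $(=(1+\lambda t)^{x/\lambda})$, $e_\lambda(t)=e_\lambda^1(t)$, $e_\lambda^{-1}(x)=1/e_\lambda(x)$ (for $\lambda=0$: $e^{xt}$). A degenerate Poisson random variable with parameter $\alpha>0$ is a random variable $X$ with $P\{X=i\}=e_\lambda^{-1}(\alpha)\frac{\alpha^i}{i!}(1)_{i,\lambda}$ for $i=0,1,2,\dots$. The dimorphic degenerate Bell polynomials are $B_{n,\lambda}(x)=\frac{1}{e_\lambda(x)}\sum_{k\ge0}\frac{(1)_{k,\lambda}}{k!}x^k k^n$ for $n\ge0$. The degenerate Lah-Bell polynomials are defined by $e_\lambda^{-1}(x)\,e_\lambda\!\big(\frac{x}{1-t}\big)=\sum_{n\ge0}B^L_{n,\lambda}(x)\frac{t^n}{n!}$.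 The unsigned Stirling numbers of the first kind are given by $\langle x\rangle_n=\sum_{k=0}^n|S_1(n,k)|x^k$. *)

(* Defs.v *)
From HB Require Import structures.
From mathcomp Require Import all_boot all_order all_algebra.
From mathcomp Require Import all_classical all_reals all_analysis.

Set Implicit Arguments.
Unset Strict Implicit.
Unset Printing Implicit Defensive.

Import Order.TTheory GRing.Theory Num.Theory.
Import numFieldNormedType.Exports.

Local Open Scope classical_set_scope.
Local Open Scope ring_scope.

(* <x>_n, over any semiring so that x can also be the indeterminate 'X *)
Definition rising_fact (A : pzSemiRingType) (x : A) (n : nat) : A :=
  \prod_(i < n) (x + i%:R).

(* |S_1(n, k)| is the coefficient of x^k in <x>_n *)
Definition stirling1u (n k : nat) : nat := ((rising_fact 'X n : {poly nat})`_k)%R.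

Section Degenerate.
Context {R : realType}.
Implicit Types (lambda x t alpha : R).

(* (x)_{n,lambda} *)
Definition degen_falling lambda x (n : nat) : R :=
  \prod_(i < n) (x - i%:R * lambda).

(* e_lambda^x(t), as the sum of its series (meaningful where it converges) *)
Definition degen_exp lambda x t : R :=
  limn (series (fun n => degen_falling lambda x n * t ^+ n / n`!%:R)).

(* B_{n,lambda}(x); note that 0 ^+ 0 = 1 *)
Definition dimorphic_bell lambda (n : nat) x : R :=
  (degen_exp lambda 1 x)^-1 *
  limn (series (fun k =>
    degen_falling lambda 1 k / k`!%:R * x ^+ k * k%:R ^+ n)).

Definition is_egf (b : nat -> R) (f : R -> R) : Prop :=
  \forall t \near (0 : R),
    series (fun n => b n * t ^+ n / n`!%:R) @ \oo --> f t.

(* B^L_{n,lambda}(x): the sequence having the given exponential generating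
   function; such a sequence is unique when it exists *)
Definition degen_lah_bell lambda (n : nat) x : R :=
  get [set b : nat -> R |
    is_egf b (fun t => (degen_exp lambda 1 x)^-1 *
                       degen_exp lambda 1 (x / (1 - t)))] n.

(* Since X takes its values in nat and P is a probability, the point masses
   sum to 1; this forces the series of e_lambda(alpha) to converge. *)
Definition degen_poisson d (T : measurableType d) (P : probability T R)
    (X : {RV P >-> nat}) lambda alpha : Prop :=
  forall i : nat, P [set w | X w = i] =
    ((degen_exp lambda 1 alpha)^-1 * (alpha ^+ i / i`!%:R) *
     degen_falling lambda 1 i)%:E.

End Degenerate.

(* Main.v *)
(* Let p_k = P(X = k) = a_k / c with a_k = (1)_{k,lambda} alpha^k / k! and
   c = e_lambda(alpha).  That the p_k are probabilities forces a_k >= 0, c > 0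
   and -alpha lambda < 1, so that sum_k p_k s^k < oo for some s > 1 and X has
   all moments.  Expanding <X>_n in powers of X gives the first identity.  For
   the second, <k>_n / n! are the Taylor coefficients of (1 - t)^(-k), with
   partial sums bounded by (1 - |t|)^(-k); by dominated convergence
     sum_n E<X>_n t^n / n! = E (1 - t)^(-X) = e_lambda(alpha / (1 - t)) / c
   for t near 0, and an exponential generating function determines its
   coefficients. *)
Require Import Defs.
From HB Require Import structures.
From mathcomp Require Import all_boot all_order all_algebra.
From mathcomp Require Import all_classical all_reals all_analysis measurable_realfun.
From mathcomp Require Import ring lra.

Set Implicit Arguments.
Unset Strict Implicit.
Unset Printing Implicit Defensive.

Import Order.TTheory GRing.Theory Num.Theory.
Import numFieldNormedType.Exports.

Local Open Scope classical_set_scope.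
Local Open Scope ring_scope.

(** * Rising factorials and their expansion in powers *)

Section rising_factorial.

Lemma rising_fact0 (A : pzSemiRingType) (x : A) : rising_fact x 0 = 1.
Proof. by rewrite /rising_fact big_ord0. Qed.

Lemma rising_factSr (A : pzSemiRingType) (x : A) n :
  rising_fact x n.+1 = rising_fact x n * (x + n%:R).
Proof. by rewrite /rising_fact big_ord_recr. Qed.

Lemma rising_factSl (A : pzSemiRingType) (x : A) n :
  rising_fact x n.+1 = x * rising_fact (x + 1) n.
Proof.
rewrite /rising_fact big_ord_recl addr0; congr (_ * _).
by apply: eq_bigr => i _; rewrite -addrA -natr1 [1 + _]addrC natr1.
Qed.

Lemma size_rising_factX n : (size (rising_fact 'X n : {poly nat}) <= n.+1)%N.
Proof.
elim: n => [|n IHn]; first by rewrite rising_fact0 size_poly1.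
rewrite rising_factSr (leq_trans (size_polyMleq _ _))//.
have sX : (size ('X + n%:R : {poly nat})%R <= 2)%N.
  rewrite (leq_trans (size_polyD _ _))// geq_max size_polyX/=.
  by rewrite -polyC_natr (leq_trans (size_polyC_leq1 _)).
by rewrite -subn1 leq_subLR (leq_trans (leq_add IHn sX))// addn2.
Qed.

(** [stirling1u] reads its coefficients off a polynomial over nat, so that polynomial is first
    carried to R by the semiring morphism [GRing.natmul 1], then evaluated at [x]. *)
Lemma rising_fact_stirling1u (R : comNzRingType) (x : R) n :
  rising_fact x n = \sum_(k < n.+1) (stirling1u n k)%:R * x ^+ k.
Proof.
have natrE : map_poly (GRing.natmul (1 : R)) (rising_fact 'X n : {poly nat}) =
    rising_fact 'X n.
  rewrite /rising_fact rmorph_prod; apply: eq_bigr => i _.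
  by rewrite rmorphD/= map_polyX rmorph_nat.
transitivity (map_poly (GRing.natmul (1 : R)) (rising_fact 'X n : {poly nat})).[x].
  rewrite natrE /rising_fact horner_prod; apply: eq_bigr => i _.
  by rewrite hornerD hornerX -polyC_natr hornerC.
rewrite (horner_coef_wide (n := n.+1)); last first.
  exact: leq_trans (size_poly _ _) (size_rising_factX n).
by apply: eq_bigr => k _; rewrite coef_map.
Qed.

End rising_factorial.

(** * The Taylor series of (1 - t)^(-k) *)

Section negative_binomial.
Context {R : realType}.
Implicit Types t : R.

Definition rising_series (k : nat) t : R ^nat :=
  series (fun n => rising_fact (k%:R : R) n * t ^+ n / n`!%:R).

Lemma rising_fact_ge0 (k n : nat) : 0 <= rising_fact (k%:R : R) n.
Proof. by apply: prodr_ge0 => i _; rewrite addr_ge0. Qed.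

(** Since <k>_n / n! is the binomial coefficient of k + n - 1 over n, this is Pascal's rule. *)
Lemma rising_fact_pascal (k n : nat) :
  rising_fact (k.+1%:R : R) n.+1 / n.+1`!%:R =
  rising_fact (k.+1%:R : R) n / n`!%:R + rising_fact (k%:R : R) n.+1 / n.+1`!%:R.
Proof.
rewrite rising_factSr rising_factSl natr1 factS natrM.
have := pnatr_eq0 R n`!; rewrite -[n`! == 0]negbK -lt0n fact_gt0 => /negbT.
rewrite -!natr1 => n0; field.
by rewrite n0 natr1 pnatr_eq0.
Qed.

(** Truncated form of (1 - t) (1 - t)^(-(k+1)) = (1 - t)^(-k): by Pascal's rule the product
    telescopes, up to one boundary term. *)
Lemma rising_seriesS k t N : (1 - t) * rising_series k.+1 t N.+1 =
  rising_series k t N.+1 - t * (rising_fact (k.+1%:R : R) N * t ^+ N / N`!%:R).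
Proof.
elim: N => [|N IHN].
  by rewrite /rising_series /series/= !big_nat1 !rising_fact0 expr0; field.
rewrite [rising_series k.+1 t _]seriesSr [rising_series k t _]seriesSr.
rewrite mulrDr IHN.
rewrite [rising_fact k.+1%:R N.+1 * _ / _]mulrAC [rising_fact k%:R _ * _ / _]mulrAC.
rewrite [rising_fact k.+1%:R N * _ / _]mulrAC rising_fact_pascal exprS.
rewrite -/(rising_series k t N.+1); ring.
Qed.

Lemma rising_series_ge0 k t N : 0 <= t -> 0 <= rising_series k t N.
Proof.
move=> t0; apply: sumr_ge0 => i _.
by rewrite divr_ge0// mulr_ge0 ?exprn_ge0// rising_fact_ge0.
Qed.

Lemma rising_series0 t N : rising_series 0 t N.+1 = 1.
Proof.
elim: N => [|N IHN].
  by rewrite /rising_series /series/= big_nat1 rising_fact0 expr0 fact0 !mul1r invr1.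
by rewrite [LHS]seriesSr -/(rising_series 0 t N.+1) IHN rising_factSl !mul0r addr0.
Qed.

Lemma rising_series_le k t N : 0 <= t -> t < 1 ->
  rising_series k t N <= (1 - t) ^- k.
Proof.
move=> t0 t1; have t1_gt0 : 0 < 1 - t by rewrite subr_gt0.
elim: k N => [|k IHk] [|N].
- by rewrite /rising_series /series/= big_geq// expr0 invr1.
- by rewrite rising_series0 expr0 invr1.
- by rewrite /rising_series /series/= big_geq// invr_ge0 exprn_ge0// ltW.
rewrite exprSr invfM ler_pdivlMr// mulrC rising_seriesS.
rewrite (le_trans _ (IHk N.+1))// gerBl mulr_ge0// divr_ge0// mulr_ge0//.
  exact: rising_fact_ge0.
by rewrite exprn_ge0.
Qed.

Lemma normr_rising_term k n t :
  `|rising_fact (k%:R : R) n * t ^+ n / n`!%:R| =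
  rising_fact (k%:R : R) n * `|t| ^+ n / n`!%:R.
Proof. by rewrite !normrM normfV normr_nat normrX ger0_norm// rising_fact_ge0. Qed.

Lemma normr_rising_series_le k t N : `|t| < 1 ->
  `|rising_series k t N| <= (1 - `|t|) ^- k.
Proof.
move=> t1; rewrite (le_trans _ (rising_series_le k N _ t1))//.
rewrite (le_trans (ler_norm_sum _ _ _))//.
by under eq_bigr do rewrite normr_rising_term.
Qed.

(** The uniform bound gives absolute convergence, so the general term tends to 0; the boundary term
    of [rising_seriesS] then vanishes in the limit and induction on [k] identifies the sum. *)
Lemma cvg_rising_series k t : `|t| < 1 ->
  rising_series k t @ \oo --> (1 - t) ^- k.
Proof.
move=> t1.
have t1_neq0 : 1 - t != 0.
  by rewrite subr_eq0; apply/eqP => t1E; rewrite -t1E normr1 ltxx in t1.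
have cvgk j : cvgn (rising_series j t).
  apply: normed_cvg.
  apply: nondecreasing_is_cvgn.
    by apply/nondecreasing_seqP => n; rewrite /= [leRHS]seriesSr lerDl.
  exists ((1 - `|t|) ^- j) => _ [N _ <-].
  rewrite /= /series/=; under eq_bigr do rewrite normr_rising_term.
  exact: rising_series_le.
elim: k => [|k IHk].
  rewrite -cvg_shiftS expr0 invr1/=.
  by under eq_fun do rewrite rising_series0; exact: cvg_cst.
rewrite -cvg_shiftS/=.
have -> : (fun N => rising_series k.+1 t N.+1) = (fun N => (rising_series k t N.+1 -
    t * (rising_fact (k.+1%:R : R) N * t ^+ N / N`!%:R)) / (1 - t)).
  by apply/funext => N; rewrite -rising_seriesS mulrC mulKf.
rewrite exprSr invfM.
have -> : (1 - t) ^- k / (1 - t) = ((1 - t) ^- k - t * 0) / (1 - t).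
  by rewrite mulr0 subr0.
apply: cvgMr_tmp; apply: cvgB; first by rewrite (cvg_shiftS (rising_series k t)).
by apply: cvgMl_tmp; apply: cvg_series_cvg_0; exact: cvgk.
Qed.

End negative_binomial.

(** * Uniqueness of the coefficients of a power series *)

Section power_series_uniqueness.
Context {R : realType}.

(** Strong induction: once the lower coefficients vanish, the partial sums at q r are u_n (q r)^n
    plus a tail of order q^(n+1). Their limit is 0, so dividing by q^n and letting q tend to 0 gives
    u_n = 0. *)
Lemma power_series_eq0 (u : R ^nat) :
  (\forall t \near (0 : R), series (fun n => u n * t ^+ n) @ \oo --> (0 : R)) ->
  forall n, u n = 0.
Proof.
move=> /nbhs_ballP[e /= e0 He] n.
elim/ltn_ind: n => n IHn.
pose r := e / 2; have r0 : 0 < r by rewrite divr_gt0.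
have re : r < e by rewrite ltr_pdivrMr// ltr_pMr// ltr1n.
have Hcvg (t : R) : 0 <= t -> t <= r -> series (fun n => u n * t ^+ n) @ \oo --> (0 : R).
  by move=> t0 tr; apply: He; rewrite /ball/= sub0r normrN ger0_norm// (le_lt_trans tr).
have [M M0 HM] : exists2 M, 0 < M & forall k, `|u k * r ^+ k| <= M.
  have : cvgn (series (fun n => u n * r ^+ n)).
    by apply/cvg_ex; exists 0; apply: Hcvg => //; exact: ltW.
  move=> /cvg_series_bounded/pinfty_ex_gt0[M M0 HM].
  by exists M => // k; exact: HM.
(* bounding the tail of the series at t = q r by a geometric one *)
have key (q : R) : 0 < q -> q < 1 -> `|u n * r ^+ n| <= M * q / (1 - q).
  move=> q0 q1; pose t := q * r.
  have qn : 0 < q ^+ n by rewrite exprn_gt0.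
  have bnd m : `|u n * t ^+ n| <=
      `|series (fun n => u n * t ^+ n) (n.+1 + m)%N| + M * q ^+ n.+1 / (1 - q).
    have -> : u n * t ^+ n = series (fun n => u n * t ^+ n) (n.+1 + m)%N -
        \sum_(0 <= j < m) u (n.+1 + j)%N * t ^+ (n.+1 + j).
      rewrite /series/= (big_cat_nat (n := n.+1))//= ?leq_addr//.
      rewrite big_nat_recr//= big_nat big1 => [|i /andP[_ ni]]; last first.
        by rewrite IHn// mul0r.
      rewrite add0r -[X in \sum_(X <= _ < _) _]add0n big_addn addKn.
      by under [X in _ + X - _]eq_bigr do rewrite addnC; rewrite addrK.
    rewrite (le_trans (ler_normB _ _))// lerD2l.
    have := geometric_le_lim m (ltW (mulr_gt0 M0 (exprn_gt0 n.+1 q0))) q0.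
    rewrite ger0_norm ?(ltW q0)// => /(_ q1); apply: le_trans.
    rewrite (le_trans (ler_norm_sum _ _ _))// /series/= ler_sum// => j _.
    rewrite /t exprMn mulrCA normrM mulrC.
    rewrite (ger0_norm (exprn_ge0 _ (ltW q0))) -mulrA -exprD.
    by rewrite ler_wpM2r// exprn_ge0// ltW.
  (* Letting [m] grow in [bnd] removes the partial sum, which tends to 0 because [t] lies between 0
     and [r]. *)
  have lim0 : `|u n * t ^+ n| <= 0 + M * q ^+ n.+1 / (1 - q).
    pose F m := `|series (fun n => u n * t ^+ n) (m + n.+1)%N| + M * q ^+ n.+1 / (1 - q).
    have FE : F @ \oo --> 0 + M * q ^+ n.+1 / (1 - q).
      apply: cvgD; last exact: cvg_cst.
      rewrite -(normr0 R); apply: cvg_norm.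
      rewrite (cvg_shiftn n.+1 (series (fun n => u n * t ^+ n))).
      by apply: Hcvg; [rewrite mulr_ge0 ?ltW|rewrite /t ler_piMl ?ltW].
    have uE : (fun=> `|u n * t ^+ n|) @ \oo --> `|u n * t ^+ n| by exact: cvg_cst.
    by apply: (ler_cvg_to uE FE); apply: nearW => m; rewrite /F addnC; exact: bnd.
  move: lim0; rewrite add0r /t exprMn mulrCA normrM (ger0_norm (ltW qn)) => lim0.
  have qE : M * (q * q ^+ n) / (1 - q) = q ^+ n * (M * q / (1 - q)) by ring.
  by rewrite -(ler_pM2l qn) -qE -exprS.
apply/eqP; rewrite -normr_eq0 eq_le normr_ge0 andbT.
suff : `|u n * r ^+ n| <= 0.
  rewrite normrM (ger0_norm (exprn_ge0 n (ltW r0))).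
  by rewrite pmulr_lle0// exprn_gt0.
apply/ler_addgt0Pl => d d0; rewrite addr0.
(* This [q] is the solution of M q / (1 - q) = d. *)
pose q := d / (M + d).
have Md : 0 < M + d by rewrite addr_gt0.
have q0 : 0 < q by rewrite divr_gt0.
have q1 : q < 1 by rewrite ltr_pdivrMr// mul1r ltrDr.
rewrite (le_trans (key _ q0 q1))//.
have -> : M * q / (1 - q) = d by rewrite /q; field; rewrite !gt_eqF//; lra.
by [].
Qed.

Lemma is_egf_unique (b b' : R ^nat) (f : R -> R) :
  is_egf b f -> is_egf b' f -> b = b'.
Proof.
move=> bf b'f; apply/funext => n.
have : (b n - b' n) / n`!%:R = 0.
  apply: (@power_series_eq0 (fun n => (b n - b' n) / n`!%:R)).
  near=> t; rewrite -(subrr (f t)).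
  have -> : series (fun n => (b n - b' n) / n`!%:R * t ^+ n) =
    series (fun n => b n * t ^+ n / n`!%:R) - series (fun n => b' n * t ^+ n / n`!%:R).
    apply/funext => N; rewrite /series/= fctE -sumrB; apply: eq_bigr => i _.
    ring.
  apply: cvgB.
    by near: t; exact: bf.
  by near: t; exact: b'f.
move/eqP; rewrite mulf_eq0 invr_eq0 pnatr_eq0 -[n`! == 0%N]negbK -lt0n fact_gt0 orbF.
by rewrite subr_eq0 => /eqP.
Unshelve. all: by end_near. Qed.

End power_series_uniqueness.

(** * Radius of convergence of the series with terms a_k s^k *)

Section degenerate_radius.
Context {R : realType}.
Variables lambda alpha : R.

(** The terms of the series of e_lambda(alpha), with factors grouped as in [dimorphic_bell]. *)
Definition degen_term (k : nat) : R :=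
  degen_falling lambda 1 k / k`!%:R * alpha ^+ k.

Hypothesis alpha_gt0 : 0 < alpha.
Hypothesis term_ge0 : forall k, 0 <= degen_term k.
Hypothesis term_cvg : cvgn (series degen_term).

Lemma degen_term0 : degen_term 0 = 1.
Proof. by rewrite /degen_term /degen_falling big_ord0 fact0 expr0 invr1 !mulr1. Qed.

(** The ratio a_(k+1) / a_k in a division-free form, since a_k may vanish. The ratio behaves like
    -alpha lambda for large k. *)
Lemma degen_termS k :
  k.+1%:R * degen_term k.+1 = degen_term k * (alpha * (1 - k%:R * lambda)).
Proof.
rewrite /degen_term /degen_falling big_ord_recr/= factS natrM exprS invfM.
have k1 : k.+1%:R / k.+1%:R = 1 :> R by rewrite divff// pnatr_eq0.
rewrite -[RHS]mulr1 -[X in _ = _ * X]k1; ring.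
Qed.

(* Otherwise k a_k is nondecreasing, and the series dominates a harmonic one. *)
Lemma degen_param_lt1 : - (alpha * lambda) < 1.
Proof.
rewrite ltNge; apply/negP => al1.
have ak k : alpha <= k.+1%:R * degen_term k.+1.
  elim: k => [|k IHk].
    by rewrite degen_termS degen_term0 mul0r subr0 mulr1 mul1r.
  rewrite degen_termS (le_trans IHk)// [leLHS]mulrC ler_wpM2l//.
  have -> : alpha * (1 - k.+1%:R * lambda) = alpha + k.+1%:R * - (alpha * lambda).
    by ring.
  by rewrite ler_wpDl ?ler_peMr// ltW.
apply: (@dvg_harmonic R).
(* The harmonic term of index k is 1 / (k+1), hence the comparison with the series started at k =
   1. *)
have : cvgn [sequence \sum_(1 <= k < n) degen_term k]_n.
  by rewrite is_cvg_series_restrict.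
move=> /cvg_ex[l]; rewrite -cvg_shiftS => dl.
apply: (@series_le_cvg _ _ (fun k => alpha^-1 * degen_term k.+1)) => [k|k|k|].
- by rewrite /= invr_ge0.
- by rewrite mulr_ge0// invr_ge0 ltW.
- by rewrite /= mulrC ler_pdivlMr// mulrC ler_pdivrMr// mulrC.
apply/cvg_ex; exists (alpha^-1 * l).
rewrite (_ : series _ = (fun n => alpha^-1 * \sum_(1 <= k < n.+1) degen_term k)).
  exact: cvgMl_tmp.
by apply/funext => n; rewrite /series/= big_distrr/= big_add1.
Qed.

(** The ratios of consecutive a_k are asymptotically at most some m < 1, so for r with 1 < r and r m
    < 1 the products a_k r^k are eventually nonincreasing, hence bounded. *)
Lemma degen_term_geometric_bound :
  exists2 r : R, 1 < r & exists M, forall k, degen_term k * r ^+ k <= M.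
Proof.
pose m := Num.max 0 (- (alpha * lambda)).
have m0 : 0 <= m by rewrite le_max lexx.
have mal : - (alpha * lambda) <= m by rewrite le_max lexx orbT.
have m1 : m < 1 by rewrite gt_max ltr01 degen_param_lt1.
have m1_gt0 : 0 < 1 + m by lra.
(* For m > 0 this is the harmonic mean of 1 and 1 / m; for m = 0 it is 2. *)
pose r := 2 / (1 + m).
have rE : r * (1 + m) = 2 by rewrite /r divfK// gt_eqF.
have r1 : 1 < r by rewrite ltr_pdivlMr//; lra.
have rm : r * m < 1 by nra.
have r0 : 0 <= r by lra.
exists r => //.
(* For k >= K one has alpha r + r m k <= k, which forces the ratio of consecutive a_k r^k to be at
   most 1. *)
have [K HK] : exists K : nat, alpha * r / (1 - r * m) < K%:R.
  exists (Num.Def.archi_bound (alpha * r / (1 - r * m))); apply: archi_boundP.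
  by apply: divr_ge0; [apply: mulr_ge0 => //; exact: ltW|lra].
have decr k : (K <= k)%N -> degen_term k.+1 * r ^+ k.+1 <= degen_term k * r ^+ k.
  move=> Kk; rewrite exprS mulrA ler_wpM2r ?exprn_ge0//.
  have k1 : 0 < k.+1%:R :> R by [].
  rewrite -(ler_pM2l k1) mulrA degen_termS -mulrA mulrC ler_wpM2r//.
  have ? : alpha * r <= k%:R * (1 - r * m).
    rewrite -ler_pdivrMr ?subr_gt0// (le_trans (ltW HK))// ler_nat//.
  have k0 : 0 <= k%:R :> R by [].
  have ? : r * - (alpha * lambda) * k%:R <= r * m * k%:R.
    by rewrite ler_wpM2r// ler_wpM2l.
  rewrite -natr1; nra.
(* A sum of nonnegative terms stands in for the maximum over the indices up to [K]. *)
exists (\sum_(j < K.+1) degen_term j * r ^+ j) => k.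
have t0 j : 0 <= degen_term j * r ^+ j.
  by rewrite mulr_ge0// exprn_ge0.
have small j : (j <= K)%N -> degen_term j * r ^+ j <=
    \sum_(j < K.+1) degen_term j * r ^+ j.
  move=> jK; rewrite (bigD1 (Ordinal (jK : (j < K.+1)%N)))//= lerDl.
  exact: sumr_ge0.
have [/small//|/ltnW Kk] := leqP k K.
rewrite -(subnKC Kk); elim: (k - K)%N => [|j IHj]; first by rewrite addn0 small.
by rewrite addnS (le_trans (decr _ _))// leq_addr.
Qed.

(** Comparison with a geometric series of ratio s / r. The room above 1 admits s = 1 / (1 - |t|) for
    t near 0. *)
Lemma degen_term_radius : exists2 r : R, 1 < r &
  forall s, 0 <= s -> s < r -> cvgn (series (fun k => degen_term k * s ^+ k)).
Proof.
have [r r1 [M HM]] := degen_term_geometric_bound.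
have r0 : 0 < r by rewrite (lt_trans _ r1).
exists r => // s s0 sr.
have M0 : 0 <= M by rewrite (le_trans _ (HM 0%N))// degen_term0 expr0 mulr1.
apply: (@series_le_cvg _ _ (geometric M (s / r))) => [k|k|k|].
- by rewrite mulr_ge0// exprn_ge0.
- by rewrite /= mulr_ge0// exprn_ge0// divr_ge0// ltW.
- rewrite /= expr_div_n mulrA ler_pdivlMr ?exprn_gt0//.
  by rewrite mulrAC ler_wpM2r// exprn_ge0.
apply: is_cvg_geometric_series.
by rewrite ger0_norm ?divr_ge0 ?(ltW r0)// ltr_pdivrMr// mul1r.
Qed.

End degenerate_radius.

(** * Integrals of functions of a random variable with values in nat *)

Section nat_valued.
Context {R : realType} d (T : measurableType d) (P : probability T R).
Variables (X : {RV P >-> nat}) (p : R ^nat).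
Hypothesis XP : forall i, P [set w | X w = i] = (p i)%:E.

Let measurable_fiber i : measurable [set w | X w = i].
Proof.
rewrite -[X in measurable X]setTI.
by apply: (measurable_funPT X measurableT [set i]).
Qed.

Lemma measurable_natfun (f : nat -> R) : measurable_fun setT (fun w => (f (X w))%:E).
Proof.
by apply/measurable_EFinP; apply: (measurableT_comp (f := f) (g := X)).
Qed.

Lemma pmf_ge0 i : 0 <= p i.
Proof. by rewrite -lee_fin -XP. Qed.

Let fiber_trivIset : trivIset setT (fun i => [set w | X w = i]).
Proof. exact: trivIset_preimage1. Qed.

Let bigcup_fiber : \bigcup_i [set w | X w = i] = setT.
Proof. by rewrite -subTset => w _; exists (X w). Qed.

Let integral_fiber (f : nat -> R) i :
  (\int[P]_(w in [set w | X w = i]) (f (X w))%:E)%E = (p i * f i)%:E.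
Proof.
rewrite (eq_integral (cst (f i)%:E)) => [|w]; last by rewrite inE/= => ->.
by rewrite integral_cst// mulrC EFinM; congr (_ * _)%E; exact: XP.
Qed.

Lemma pmf_sum1 : series p @ \oo --> (1 : R).
Proof.
have sum1 : (1%:E = \sum_(0 <= i <oo) P [set w | X w = i])%E.
  rewrite -(probability_setT P) -[in LHS]bigcup_fiber.
  by apply: measure_semi_bigcup => //; rewrite bigcup_fiber.
have : (\sum_(0 <= i < n) P [set w | X w = i])%E @[n --> \oo] --> 1%:E.
  by rewrite sum1; apply: is_cvg_nneseries.
rewrite (_ : (fun n => _) = EFin \o series p); first by move/fine_cvg.
by apply/funext => n; rewrite /= -sumEFin; apply: eq_bigr => i _; exact: XP.
Qed.

(** The fibres of [X] form a countable partition on which the integrand is constant, so the integral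
    of its absolute value is a series against the masses [p i]. *)
Lemma integrable_natfun (f : nat -> R) :
  cvgn (series (fun i => p i * `|f i|)) ->
  P.-integrable setT (fun w => (f (X w))%:E).
Proof.
move=> fc; apply/integrableP; split; first exact: measurable_natfun.
rewrite -bigcup_fiber ge0_integral_bigcup//; last first.
  rewrite bigcup_fiber; apply: measurableT_comp => //; exact: measurable_natfun.
under eq_eseriesr do rewrite (integral_fiber (fun j => `|f j|)).
have -> : (fun n => \sum_(0 <= i < n) (p i * `|f i|)%:E)%E =
    EFin \o series (fun i => p i * `|f i|).
  by apply/funext => n; rewrite sumEFin.
by rewrite EFin_lim// ltry.
Qed.

Lemma integral_natfun (f : nat -> R) :
  cvgn (series (fun i => p i * `|f i|)) ->
  (\int[P]_w (f (X w))%:E)%E = (limn (series (fun i => p i * f i)))%:E.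
Proof.
move=> fc; rewrite -[in LHS]bigcup_fiber integral_bigcup//; last first.
  by rewrite bigcup_fiber; exact: integrable_natfun.
under eq_eseriesr do rewrite (integral_fiber f).
have -> : (fun n => \sum_(0 <= i < n) (p i * f i)%:E)%E =
    EFin \o series (fun i => p i * f i).
  by apply/funext => n; rewrite sumEFin.
rewrite EFin_lim//; apply: normed_cvg.
rewrite (_ : [normed series _] = series (fun i => p i * `|f i|))//.
apply/funext => n; rewrite /series/=; apply: eq_bigr => i _.
by rewrite normrM (ger0_norm (pmf_ge0 i)).
Qed.

End nat_valued.

(** * Weighted series, growth of rising factorials, and the sequence chosen by [degen_lah_bell] *)

Lemma limn_series_lincomb (R : realType) (p : R ^nat) (g : nat -> R ^nat)
    (c : R ^nat) N :
  (forall i, cvgn (series (fun k => p k * g i k))) ->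
  series (fun k => p k * \sum_(i < N) c i * g i k) @ \oo -->
  \sum_(i < N) c i * limn (series (fun k => p k * g i k)).
Proof.
move=> gc.
rewrite (_ : series _ = (fun m => \sum_(i < N) c i * series (fun k => p k * g i k) m)).
  elim: N => [|N IHN].
    by under eq_fun do rewrite big_ord0; rewrite big_ord0; exact: cvg_cst.
  under eq_fun do rewrite big_ord_recr/=; rewrite big_ord_recr/=.
  by apply: cvgD => //; apply: cvgMl_tmp; exact: gc.
apply/funext => m; rewrite /series/=.
under eq_bigr do rewrite big_distrr/=.
rewrite exchange_big/=; apply: eq_bigr => i _; rewrite big_distrr/=.
by apply: eq_bigr => k _; rewrite mulrCA.
Qed.

Lemma cvg_series_normM (R : realType) (p f : R ^nat) (C s : R) :
  (forall k, 0 <= p k) -> (forall k, `|f k| <= C * s ^+ k) ->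
  cvgn (series (fun k => p k * s ^+ k)) ->
  cvgn (series (fun k => p k * `|f k|)).
Proof.
move=> p0 fs ps.
apply: (@series_le_cvg _ _ (fun k => C * (p k * s ^+ k))) => [k|k|k|].
- by rewrite mulr_ge0.
- by rewrite mulrCA mulr_ge0// (le_trans _ (fs k)).
- by rewrite mulrCA ler_wpM2l.
rewrite (_ : series _ = (fun n => C * series (fun k => p k * s ^+ k) n)).
  by apply/cvg_ex; eexists; apply: cvgMl_tmp; exact: ps.
by apply/funext => n; rewrite /series/= big_distrr.
Qed.

(** <k>_n t^n / n! is a single term of a nonnegative series bounded by (1 - t)^(-k). For fixed [n]
    and [t] the bound is geometric in [k]. *)
Lemma rising_fact_le_geometric (R : realType) (k n : nat) (t : R) : 0 < t -> t < 1 ->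
  rising_fact (k%:R : R) n <= n`!%:R / t ^+ n * ((1 - t)^-1) ^+ k.
Proof.
move=> t0 t1; rewrite exprVn.
have n0 : 0 < n`!%:R :> R by rewrite ltr0n fact_gt0.
have tn0 : 0 < t ^+ n by rewrite exprn_gt0.
rewrite mulrAC ler_pdivlMr// [leRHS]mulrC -ler_pdivrMr//.
apply: le_trans (rising_series_le k n.+1 (ltW t0) t1).
rewrite /rising_series seriesSr lerDr.
exact: rising_series_ge0 (ltW t0).
Qed.

Lemma exprn_le_rising_fact (R : realType) (k n : nat) :
  k%:R ^+ n <= rising_fact (k%:R : R) n.
Proof.
elim: n => [|n IHn]; first by rewrite rising_fact0.
rewrite rising_factSr exprSr ler_pM// ?exprn_ge0// lerDl//.
Qed.

(** [b] inhabits the set, so [get] returns a genuine member rather than a default, and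
    [is_egf_unique] identifies it with [b]. *)
Lemma degen_lah_bell_unique (R : realType) (lambda x : R) (b : R ^nat) n :
  is_egf b (fun t => (degen_exp lambda 1 x)^-1 * degen_exp lambda 1 (x / (1 - t))) ->
  degen_lah_bell lambda n x = b n.
Proof.
set f := (fun t => _) => bf; rewrite /degen_lah_bell.
suff -> : [get b' : R ^nat | is_egf b' f] = b by [].
apply: (is_egf_unique _ bf).
exact: (@getPex _ [set b' : R ^nat | is_egf b' f] (ex_intro _ b bf)).
Qed.

(** * Moments of the degenerate Poisson variable and their generating function *)

Section degenerate_poisson.
Context {R : realType} d (T : measurableType d) (P : probability T R).
Variables (X : {RV P >-> nat}) (lambda alpha : R).
Hypotheses (alpha_gt0 : 0 < alpha) (X_poisson : degen_poisson X lambda alpha).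

Let c := degen_exp lambda 1 alpha.
Let p (k : nat) := c^-1 * degen_term lambda alpha k.

Let XP i : P [set w | X w = i] = (p i)%:E.
Proof. by rewrite X_poisson /p /degen_term; congr (_%:E); rewrite -/c; ring. Qed.

Let p_ge0 i : 0 <= p i. Proof. exact: (pmf_ge0 XP). Qed.

Let p_sum1 : series p @ \oo --> (1 : R). Proof. exact: (pmf_sum1 XP). Qed.

(** The mass at 0 is 1 / c, so c is nonnegative; if c were 0, the convention 0^-1 = 0 would make
    every mass vanish, against total mass 1. *)
Lemma degen_poisson_exp_gt0 : 0 < c.
Proof.
rewrite lt_neqAle -invr_ge0; apply/andP; split; last first.
  by have := p_ge0 0; rewrite /p degen_term0 mulr1.
apply/eqP => c0; have := p_sum1.
rewrite (_ : series p = cst 0).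
  move=> /(cvg_lim (@Rhausdorff R)); rewrite lim_cst// => /eqP.
  by rewrite eq_sym oner_eq0.
apply/funext => n; rewrite /series/= big1// => i _.
by rewrite /p -c0 invr0 mul0r.
Qed.

Let termE k : degen_term lambda alpha k = c * p k.
Proof. by rewrite /p mulrA mulfV ?mul1r// gt_eqF// degen_poisson_exp_gt0. Qed.

Lemma degen_poisson_radius : exists2 r : R, 1 < r &
  forall s, 0 <= s -> s < r -> cvgn (series (fun k => p k * s ^+ k)).
Proof.
have term_ge0 k : 0 <= degen_term lambda alpha k.
  by rewrite termE mulr_ge0// ltW// degen_poisson_exp_gt0.
(* So far [c] is only the value of a [limn]; convergence comes from the masses, since a_k = c p_k
   and they sum to 1. *)
have term_cvg : cvgn (series (degen_term lambda alpha)).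
  apply/cvg_ex; exists (c * 1).
  rewrite (_ : series _ = (fun n => c * series p n)); first exact: cvgMl_tmp.
  by apply/funext => n; rewrite /series/= big_distrr; apply: eq_bigr => k _; exact: termE.
have [r r1 Hr] := degen_term_radius alpha_gt0 term_ge0 term_cvg.
exists r => // s s0 sr; apply/cvg_ex.
exists (c^-1 * limn (series (fun k => degen_term lambda alpha k * s ^+ k))).
rewrite (_ : series _ = (fun n => c^-1 *
    series (fun k => degen_term lambda alpha k * s ^+ k) n)).
  by apply: cvgMl_tmp; exact: Hr.
apply/funext => n; rewrite /series/= big_distrr/=.
by apply: eq_bigr => k _; rewrite mulrA.
Qed.

Lemma degen_poisson_cvg_rising n :
  cvgn (series (fun k => p k * `|rising_fact (k%:R : R) n|)).
Proof.
have [r r1 Hr] := degen_poisson_radius.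
have r0 : 0 < r by rewrite (lt_trans _ r1).
(* With this choice 1 - t is the midpoint of 1 / r and 1, so 1 / (1 - t) < r. *)
pose t := (1 - r^-1) / 2.
have ri : r^-1 < 1 by rewrite invf_lt1.
have ri0 : 0 < r^-1 by rewrite invr_gt0.
have t0 : 0 < t by rewrite /t; lra.
have t1 : t < 1 by rewrite /t; lra.
apply: (@cvg_series_normM _ p _ (n`!%:R / t ^+ n) (1 - t)^-1) => // [k|].
  by rewrite ger0_norm ?rising_fact_ge0// rising_fact_le_geometric.
apply: Hr; first by rewrite invr_ge0; lra.
by rewrite -[ltRHS]invrK ltf_pV2 ?posrE//; rewrite /t; lra.
Qed.

Lemma degen_poisson_cvg_exprn n :
  cvgn (series (fun k => p k * k%:R ^+ n)).
Proof.
apply: (@series_le_cvg _ _ (fun k => p k * `|rising_fact (k%:R : R) n|)) => [k|k|k|].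
- by rewrite mulr_ge0// exprn_ge0.
- by rewrite mulr_ge0.
- rewrite ler_wpM2l// ger0_norm ?rising_fact_ge0//.
  exact: exprn_le_rising_fact.
exact: degen_poisson_cvg_rising.
Qed.

Lemma dimorphic_bell_moment n :
  dimorphic_bell lambda n alpha = limn (series (fun k => p k * k%:R ^+ n)).
Proof.
rewrite /dimorphic_bell -/c.
have -> : series (fun k => degen_falling lambda 1 k / k`!%:R * alpha ^+ k * k%:R ^+ n) =
    (fun N => c * series (fun k => p k * k%:R ^+ n) N).
  apply/funext => N; rewrite /series/= big_distrr; apply: eq_bigr => k _ /=.
  by rewrite mulrA -termE.
have /cvg_lim -> // : (fun N => c * series (fun k => p k * k%:R ^+ n) N) @ \oo -->
    c * limn (series (fun k => p k * k%:R ^+ n)).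
  by apply: cvgMl_tmp; exact: degen_poisson_cvg_exprn.
by rewrite mulKf// gt_eqF// degen_poisson_exp_gt0.
Qed.

(** The common real value through which both identities pass. *)
Let rising_moment n := limn (series (fun k => p k * rising_fact (k%:R : R) n)).

Let cvg_rising n : cvgn (series (fun k => p k * rising_fact (k%:R : R) n)).
Proof.
have := @degen_poisson_cvg_rising n.
by under eq_fun do rewrite ger0_norm ?rising_fact_ge0//.
Qed.

Lemma rising_moment_stirling n : rising_moment n =
  \sum_(k < n.+1) dimorphic_bell lambda k alpha * (stirling1u n k)%:R.
Proof.
rewrite /rising_moment.
under eq_fun do rewrite rising_fact_stirling1u.
have /cvg_lim -> // := limn_series_lincomb (p := p) (g := fun i k => k%:R ^+ i)
  (c := fun i => (stirling1u n i)%:R) (N := n.+1) degen_poisson_cvg_exprn.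
by apply: eq_bigr => k _; rewrite dimorphic_bell_moment mulrC.
Qed.

Lemma expectation_rising_fact n :
  ('E_P[fun w => rising_fact ((X w)%:R : R) n] = (rising_moment n)%:E)%E.
Proof.
rewrite unlock (integral_natfun XP (f := fun k => rising_fact (k%:R : R) n))//.
exact: degen_poisson_cvg_rising.
Qed.

Lemma is_egf_rising_moment :
  is_egf rising_moment (fun t => c^-1 * degen_exp lambda 1 (alpha / (1 - t))).
Proof.
have [r r1 Hr] := degen_poisson_radius.
have r0 : 0 < r by rewrite (lt_trans _ r1).
have ri : r^-1 < 1 by rewrite invf_lt1.
have ri0 : 0 < r^-1 by rewrite invr_gt0.
rewrite /is_egf; near=> t.
(* This is the condition 1 / (1 - |t|) < r. *)
have tr : `|t| < 1 - r^-1.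
  near: t; apply/nbhs_ballP; exists (1 - r^-1) => /=; first by rewrite subr_gt0.
  by move=> t; rewrite /ball/= sub0r normrN.
have t1 : `|t| < 1 by lra.
have t1_gt0 : 0 < 1 - t by have := ler_norm t; lra.
(* The integrable function s^X dominates all partial sums of the Taylor series of (1 - t)^(-X), as
   well as its limit. *)
pose s := (1 - `|t|)^-1.
have s0 : 0 <= s by rewrite invr_ge0; lra.
have sr : s < r by rewrite -[ltRHS]invrK ltf_pV2 ?posrE//; lra.
have ps : cvgn (series (fun k => p k * `|s ^+ k|)).
  apply: (@cvg_series_normM _ p _ 1 s) => // [k|]; last exact: Hr.
  by rewrite mul1r ger0_norm// exprn_ge0.
have geo k : `|(1 - t) ^- k| <= s ^+ k.
  rewrite normfV normrX /s exprVn.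
  rewrite lef_pV2 ?posrE ?exprn_gt0 ?normr_gt0 ?gt_eqF//; last lra.
  by rewrite lerXn2r ?nnegrE//; [lra|rewrite ger0_norm; [have := ler_norm t; lra|lra]].
have pgeo : cvgn (series (fun k => p k * `|(1 - t) ^- k|)).
  apply: (@cvg_series_normM _ p _ 1 s) => // [k|]; last exact: Hr.
  by rewrite mul1r.
(* Integrating a Taylor polynomial termwise gives the partial sum of the generating function of the
   moments. *)
have partial N : (\int[P]_w (rising_series (X w) t N)%:E)%E =
    (series (fun n => rising_moment n * t ^+ n / n`!%:R) N)%:E.
  rewrite (integral_natfun XP (f := fun k => rising_series k t N)).
    congr (_%:E); rewrite /series/= big_mkord.
    rewrite (_ : (fun n => _) = series (fun k => p k *
        \sum_(i < N) t ^+ i / i`!%:R * rising_fact (k%:R : R) i)).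
      have /cvg_lim -> // := limn_series_lincomb (g := fun i k => rising_fact k%:R i)
        (c := fun i => t ^+ i / i`!%:R) (N := N) cvg_rising.
      by apply: eq_bigr => i _; rewrite mulrC mulrA.
    apply/funext => m; rewrite /series/=; apply: eq_bigr => k _; congr (_ * _).
    rewrite /rising_series /series/= big_mkord; apply: eq_bigr => i _.
    by rewrite -mulrA mulrC.
  apply: (@cvg_series_normM _ p _ 1 s) => // [k|]; last exact: Hr.
  by rewrite mul1r /s exprVn normr_rising_series_le.
have : (\int[P]_w (rising_series (X w) t N)%:E)%E @[N --> \oo] -->
    (\int[P]_w ((1 - t) ^- X w)%:E)%E.
  apply: (@dominated_cvg _ _ _ P setT measurableT _ _ (fun w => (s ^+ X w)%:E)) => //.
  - by move=> N; exact: (measurable_natfun X (fun k => rising_series k t N)).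
  - move=> w _; apply: cvg_EFin; first exact: nearW.
    exact: cvg_rising_series.
  - exact: (integrable_natfun XP (f := fun k => s ^+ k)).
  - by move=> N w _; rewrite lee_fin /s exprVn normr_rising_series_le.
rewrite (integral_natfun XP (f := fun k => (1 - t) ^- k))//.
under eq_fun do rewrite partial.
move=> /fine_cvg; rewrite /comp/=.
suff -> : c^-1 * degen_exp lambda 1 (alpha / (1 - t)) =
  limn (series (fun k => p k * (1 - t) ^- k)) by [].
rewrite /degen_exp.
(* Replacing alpha by alpha / (1 - t) multiplies a_k = c p_k by (1 - t)^(-k). *)
rewrite (_ : series _ = (fun N => c * series (fun k => p k * (1 - t) ^- k) N)).
  have /cvg_lim -> // : (fun N => c * series (fun k => p k * (1 - t) ^- k) N) @ \oo -->
      c * limn (series (fun k => p k * (1 - t) ^- k)).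
    apply: cvgMl_tmp; apply: normed_cvg.
    rewrite (_ : [normed series _] = series (fun k => p k * `|(1 - t) ^- k|))//.
    apply/funext => n; rewrite /series/=; apply: eq_bigr => k _.
    by rewrite normrM (ger0_norm (p_ge0 k)).
  by rewrite mulKf// gt_eqF// degen_poisson_exp_gt0.
apply/funext => N; rewrite /series/= big_distrr; apply: eq_bigr => k _ /=.
by rewrite mulrA -termE /degen_term expr_div_n; ring.
Unshelve. all: by end_near. Qed.

End degenerate_poisson.

Theorem theorem6 (R : realType) (d : measure_display) (T : measurableType d)
    (P : probability T R) (X : {RV P >-> nat}) (lambda alpha : R)
    (alpha_gt0 : 0 < alpha) (X_poisson : degen_poisson X lambda alpha)
    (n : nat) :
  ('E_P[fun w => rising_fact ((X w)%:R : R) n] =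
     (\sum_(k < n.+1) dimorphic_bell lambda k alpha * (stirling1u n k)%:R)%:E)%E
  /\
  degen_lah_bell lambda n alpha =
     \sum_(k < n.+1) dimorphic_bell lambda k alpha * (stirling1u n k)%:R.
Proof.
split.
  rewrite (expectation_rising_fact alpha_gt0 X_poisson).
  by rewrite (rising_moment_stirling alpha_gt0 X_poisson).
(* The right-hand side becomes the rising moment, whose generating function is the one defining
   [degen_lah_bell]. *)
rewrite -(rising_moment_stirling alpha_gt0 X_poisson).
exact: degen_lah_bell_unique (is_egf_rising_moment alpha_gt0 X_poisson).
Qed.
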